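(* Let $\mathcal{S}_K=\{(-1,0),(0,-1),(1,1)\}\subset\mathbb{Z}^2$ (the Kreweras step set), and for $t\ge 0$ and $\mathbf{b}\in\mathbb{Z}^2$ let $F_t^K(\mathbf{b})$ be the number of sequences $s_1s_2\cdots s_t$ of steps $s_i\in\mathcal{S}_K$ with $s_1+\cdots+s_t=\mathbf{b}$ (free Kreweras paths of length $t$ from $(0,0)$ to $\mathbf{b}$, no boundary constraint). Let the isometry group of the free Kreweras paths be the set of matrices $g\in GL_2(\mathbb{Z})$, acting on row vectors by $\mathbf{b}\mapsto \mathbf{b}g$, such that $F_t^K(\mathbf{b}g)=F_t^K(\mathbf{b})$ for all $t\ge0$ and all $\mathbf{b}\in\mathbb{Z}^2$. Then this group is a dihedral group $D_3$ of order six, consisting of the matrices $$g_0=\begin{pmatrix}1&0\\0&1\end{pmatrix},\ g_1=\begin{pmatrix}-1&-1\\0&1\end{pmatrix},\ g_2=\begin{pmatrix}1&0\\-1&-1\end{pmatrix},\ g_3=\begin{pmatrix}-1&-1\\1&0\end{pmatrix},\ g_4=\begin{pmatrix}0&1\\-1&-1\end{pmatrix},\ g_5=\begin{pmatrix}0&1\\1&0\end{pmatrix}.$$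
   Context: Explicitly, writing $\mathbf{b}=(a,b)$, $F_t^K(a,b)=\frac{t!}{n_1!\,n_2!\,n_3!}$ with $n_1=\frac13(t-2a+b)$, $n_2=\frac13(t+a-2b)$, $n_3=\frac13(t+a+b)$ when these are nonnegative integers, and $F_t^K(a,b)=0$ otherwise. Matrices act on the right of row vectors $(a,b)$. *)

(* Defs.v *)
From HB Require Import structures.
From mathcomp Require Import all_boot all_order all_algebra all_fingroup all_solvable.
From mathcomp Require Import boolp classical_sets functions cardinality.

Set Implicit Arguments.
Unset Strict Implicit.
Unset Printing Implicit Defensive.

Import GRing.Theory.
Local Open Scope ring_scope.

Definition row2 (a b : int) : 'rV[int]_2 := \row_j [:: a; b]`_j.

(* [a b; c d], row by row. *)
Definition mx2 (a b c d : int) : 'M[int]_2 :=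
  \matrix_(i, j) (nth [::] [:: [:: a; b]; [:: c; d]] i)`_j.

Definition kreweras_steps : seq 'rV[int]_2 :=
  [:: row2 (-1) 0; row2 0 (-1); row2 1 1].

Definition free_kreweras (t : nat) (b : 'rV[int]_2) : nat :=
  #|[set s : t.-tuple (seq_sub kreweras_steps) |
      \sum_(i < t) val (tnth s i) == b]|.

(* Row vectors, hence a right action: b (g h) = (b g) h. *)
Definition kreweras_isometry : {pred 'M[int]_2} := fun g =>
  (g \in unitmx) &&
  `[< forall (t : nat) (b : 'rV[int]_2),
        free_kreweras t (b *m g) = free_kreweras t b >].

Lemma kreweras_isometryP (g : 'M[int]_2) :
  reflect (g \in unitmx /\
           forall t b, free_kreweras t (b *m g) = free_kreweras t b)
          (g \in kreweras_isometry).
Proof. by apply: (iffP andP) => -[gu /asboolP gF]. Qed.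

Lemma kreweras_isometry1 : 1%:M \in kreweras_isometry.
Proof.
by apply/kreweras_isometryP; rewrite unitmx1; split=> // t b; rewrite mulmx1.
Qed.

Lemma kreweras_isometryM (g h : 'M[int]_2) :
  g \in kreweras_isometry -> h \in kreweras_isometry ->
  g *m h \in kreweras_isometry.
Proof.
move=> /kreweras_isometryP[gu gF] /kreweras_isometryP[hu hF].
apply/kreweras_isometryP; rewrite unitmx_mul gu hu.
by split=> // t b; rewrite mulmxA hF gF.
Qed.

Lemma kreweras_isometryV (g : 'M[int]_2) :
  g \in kreweras_isometry -> invmx g \in kreweras_isometry.
Proof.
move=> /kreweras_isometryP[gu gF]; apply/kreweras_isometryP.
by rewrite unitmx_inv; split=> // t b; rewrite -gF mulmxKV.
Qed.

Definition kreweras_isometry_group : Type :=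
  {g : 'M[int]_2 | g \in kreweras_isometry}.

HB.instance Definition _ := Choice.on kreweras_isometry_group.

Section GroupStructure.
Implicit Types g h k : kreweras_isometry_group.

Definition isometry_one : kreweras_isometry_group :=
  exist _ 1%:M kreweras_isometry1.
Definition isometry_mul g h : kreweras_isometry_group :=
  exist _ (val g *m val h) (kreweras_isometryM (valP g) (valP h)).
Definition isometry_inv g : kreweras_isometry_group :=
  exist _ (invmx (val g)) (kreweras_isometryV (valP g)).

Lemma isometry_mulA : associative isometry_mul.
Proof. by move=> g h k; apply: val_inj; rewrite /= mulmxA. Qed.

Lemma isometry_mul1 : left_id isometry_one isometry_mul.
Proof. by move=> g; apply: val_inj; rewrite /= mul1mx. Qed.

Lemma isometry_mulr1 : right_id isometry_one isometry_mul.
Proof. by move=> g; apply: val_inj; rewrite /= mulmx1. Qed.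

Lemma isometry_mulV : left_inverse isometry_one isometry_inv isometry_mul.
Proof.
move=> g; apply: val_inj; rewrite /= mulVmx //.
by have /kreweras_isometryP[] := valP g.
Qed.

Lemma isometry_mulrV : right_inverse isometry_one isometry_inv isometry_mul.
Proof.
move=> g; apply: val_inj; rewrite /= mulmxV //.
by have /kreweras_isometryP[] := valP g.
Qed.
End GroupStructure.

HB.instance Definition _ := isGroup.Build kreweras_isometry_group
  isometry_mulA isometry_mul1 isometry_mulr1 isometry_mulV isometry_mulrV.

(* Main.v *)
Require Import Defs.
From HB Require Import structures.
From mathcomp Require Import all_boot all_order all_algebra all_fingroup all_solvable.
From mathcomp Require Import boolp classical_sets functions cardinality.

Local Open Scope ring_scope.

Import GRing.Theory.

(* A walk of length 1 reaches exactly the three steps, so an isometry maps each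
   step to a step.  Conversely, an invertible matrix stabilising the step set
   acts bijectively on walks, hence preserves all path counts.  Two of the steps
   are -e1 and -e2, so such a matrix is determined by their images, and
   invertibility leaves the six injective choices.  Of these, g4 has order 3,
   g5 has order 2 and g5 inverts g4, which is a presentation of the dihedral
   group of order 6. *)

Lemma row2_eqE (a b c d : int) : (row2 a b == row2 c d) = (a == c) && (b == d).
Proof.
apply/eqP/andP => [/rowP e | [/eqP -> /eqP ->] //].
by have := e 0; have := e 1; rewrite !mxE /= => -> ->.
Qed.

Lemma mx2_eqE (a b c d a' b' c' d' : int) :
  (mx2 a b c d == mx2 a' b' c' d') =
  [&& a == a', b == b', c == c' & d == d'].
Proof.
apply/eqP/and4P => [/matrixP e | [/eqP -> /eqP -> /eqP -> /eqP ->] //].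
by have := (e 0 0, e 0 1, (e 1 0, e 1 1)); rewrite !mxE /= => -[[-> ->] [-> ->]].
Qed.

Lemma mx2_eta (g : 'M[int]_2) : g = mx2 (g 0 0) (g 0 1) (g 1 0) (g 1 1).
Proof.
by apply/matrixP => -[[|[|//]] i] -[[|[|//]] j]; rewrite !mxE /=;
   congr (g _ _); apply: val_inj.
Qed.

Lemma row2_mul_mx2 (x y a b c d : int) :
  row2 x y *m mx2 a b c d = row2 (x * a + y * c) (x * b + y * d).
Proof.
apply/rowP => -[[|[|//]] i];
by rewrite !mxE big_ord_recl big_ord1 !mxE.
Qed.

Lemma mx2_mul (a b c d a' b' c' d' : int) :
  mx2 a b c d *m mx2 a' b' c' d' =
  mx2 (a * a' + b * c') (a * b' + b * d') (c * a' + d * c') (c * b' + d * d').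
Proof.
apply/matrixP => -[[|[|//]] i] -[[|[|//]] j];
by rewrite !mxE big_ord_recl big_ord1 !mxE.
Qed.

Lemma det_mx2 (a b c d : int) : \det (mx2 a b c d) = a * d - b * c.
Proof.
rewrite (expand_det_row _ 0) big_ord_recl big_ord1 /cofactor !det_mx11 !mxE /=.
by rewrite expr0 expr1 mul1r mulN1r mulrN.
Qed.

Lemma free_kreweras1_gt0 (b : 'rV[int]_2) :
  (0 < free_kreweras 1 b)%N = (b \in kreweras_steps).
Proof.
apply/card_gt0P/idP => [[s] | bS].
  by rewrite inE big_ord1 => /eqP <-; apply: valP.
by exists [tuple SeqSub bS]; rewrite inE big_ord1 eqxx.
Qed.

Lemma free_kreweras_stable_steps (g : 'M[int]_2) (t : nat) (b : 'rV[int]_2) :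
    g \in unitmx -> {in kreweras_steps, forall s, s *m g \in kreweras_steps} ->
  free_kreweras t (b *m g) = free_kreweras t b.
Proof.
move=> gU gS; have g_inj := can_inj (@mulmxK _ _ 1 _ gU).
pose f (s : seq_sub kreweras_steps) := SeqSub (gS _ (valP s)).
have f_inj : injective f by move=> s s' /(congr1 val) /g_inj /val_inj.
pose F (s : t.-tuple (seq_sub kreweras_steps)) := [tuple of map f s].
have F_inj : injective F.
  by move=> s s' /(congr1 val) /(inj_map f_inj) /val_inj.
(* [F] is injective on a finite type, hence bijective, and a walk ends at [b] exactly when its image
   under [F] ends at [b *m g]. *)
rewrite /free_kreweras -[LHS](on_card_preimset (onW_bij _ (injF_bij F_inj))).
apply: eq_card => s; rewrite !inE -[RHS](inj_eq g_inj) mulmx_suml.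
by congr (_ == _); apply: eq_bigr => i _; rewrite tnth_map.
Qed.

(** Trades the quantifiers over all lengths and endpoints for a finite check on three vectors, which
    can be evaluated on explicit matrices. *)
Lemma kreweras_isometryE (g : 'M[int]_2) :
  (g \in kreweras_isometry) =
  (g \in unitmx) && all (fun s => s *m g \in kreweras_steps) kreweras_steps.
Proof.
apply/kreweras_isometryP/andP => -[gU gF]; split=> //.
  by apply/allP => s sS; rewrite -free_kreweras1_gt0 gF free_kreweras1_gt0.
by move=> t b; apply: free_kreweras_stable_steps => //; apply/allP.
Qed.

Definition kreweras_matrices : seq 'M[int]_2 :=
  [:: mx2 1 0 0 1;
      mx2 (-1) (-1) 0 1;
      mx2 1 0 (-1) (-1);
      mx2 (-1) (-1) 1 0;
      mx2 0 1 (-1) (-1);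
      mx2 0 1 1 0].

Lemma mem_kreweras_matrices : kreweras_isometry =i kreweras_matrices.
Proof.
move=> g; rewrite kreweras_isometryE; apply/idP/idP; last first.
  rewrite !inE; do ![case/orP]; move/eqP->;
  by rewrite unitmxE det_mx2 /= !inE !row2_mul_mx2 !row2_eqE.
rewrite (mx2_eta g); move: (g 0 0) (g 0 1) (g 1 0) (g 1 1) => a b c d.
rewrite unitmxE det_mx2 /= !inE !row2_mul_mx2 !row2_eqE !mx2_eqE.
rewrite !(mul0r, mul1r, mulN1r, add0r, addr0) ![- _ == _]eqr_oppLR.
rewrite ?(oppr0, opprK).
(* By [ab] and [cd], each row of the matrix is the negative of a step. Of the nine resulting
   matrices, the three with equal rows have determinant 0; the other six are the listed ones. *)
case/and4P => + ab cd _.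
by case/or3P: ab => /andP[/eqP-> /eqP->]; case/or3P: cd => /andP[/eqP-> /eqP->].
Qed.

(** This map and its inverse transport finiteness from the explicit list to the isometry group, so
    that finite group theory applies to it. *)
Definition kreweras_index (g : kreweras_isometry_group) :
    seq_sub kreweras_matrices :=
  SeqSub (etrans (esym (mem_kreweras_matrices _)) (valP g)).

Definition kreweras_of_index (g : seq_sub kreweras_matrices) :
    kreweras_isometry_group :=
  exist _ (val g) (etrans (mem_kreweras_matrices _) (valP g)).

Lemma kreweras_indexK : cancel kreweras_index kreweras_of_index.
Proof. by move=> g; apply: val_inj. Qed.

Lemma kreweras_of_indexK : cancel kreweras_of_index kreweras_index.
Proof. by move=> g; apply: val_inj. Qed.

HB.instance Definition _ : isCountable kreweras_isometry_group :=
  CanIsCountable kreweras_indexK.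
HB.instance Definition _ : isFinite kreweras_isometry_group :=
  CanIsFinite kreweras_indexK.

Lemma card_kreweras_isometry_group : #|{: kreweras_isometry_group}| = 6%N.
Proof.
rewrite (bij_eq_card (Bijective kreweras_indexK kreweras_of_indexK)).
by rewrite card_seq_sub //= !inE !mx2_eqE.
Qed.

(** The index in ['D_6] is the order of the group: this is the $D_3$ of the usual geometric
    notation. *)
Lemma kreweras_isometry_group_dihedral :
  [set: 'D_6] \isog [set: kreweras_isometry_group].
Proof.
have rP : mx2 0 1 (-1) (-1) \in kreweras_isometry.
  by rewrite mem_kreweras_matrices !inE eqxx !orbT.
have sP : mx2 0 1 1 0 \in kreweras_isometry.
  by rewrite mem_kreweras_matrices !inE eqxx !orbT.
pose r : kreweras_isometry_group := exist _ (mx2 0 1 (-1) (-1)) rP.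
pose s : kreweras_isometry_group := exist _ (mx2 0 1 1 0) sP.
have E1 : 1%:M = mx2 1 0 0 1 by rewrite (mx2_eta 1%:M) !mxE.
have r3 : (r ^+ 3 = 1)%g.
  by apply: val_inj; rewrite /= !mx2_mul E1; apply/eqP; rewrite mx2_eqE.
have ss : (s * s = 1)%g.
  by apply: val_inj; rewrite /= !mx2_mul E1; apply/eqP; rewrite mx2_eqE.
have rsrs : (r * (s * (r * s)) = 1)%g.
  by apply: val_inj; rewrite /= !mx2_mul E1; apply/eqP; rewrite mx2_eqE.
(* The two relations read [s^-1 = s] and [r^-1 = s * (r * s)]. *)
have rJ : (r ^ s = r^-1)%g by rewrite conjgE (mulg1_eq ss) (mulg1_eq rsrs).
have r_neq1 : r != 1%g by rewrite -val_eqE /= E1 mx2_eqE.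
have s_neq1 : s != 1%g by rewrite -val_eqE /= E1 mx2_eqE.
have or : #[r]%g = 3%N by apply: nt_prime_order.
have os : #[s]%g = 2%N by apply: nt_prime_order.
(* The generated subgroup has order divisible by the coprime numbers 3 and 2, hence at least 6. *)
have rsT : (<[r]> <*> <[s]>)%g = [set: kreweras_isometry_group].
  apply/eqP; rewrite eqEcard finset.subsetT cardsT card_kreweras_isometry_group.
  apply: (@dvdn_leq (3 * 2)%N); first exact: cardG_gt0.
  rewrite Gauss_dvd //; apply/andP; split.
    by rewrite -or cardSg ?joing_subl.
  by rewrite -os cardSg ?joing_subr.
(* The presentation makes the group generated by [r] and [s] a homomorphic image of ['D_6]; equality
   of orders turns this into an isomorphism. *)
rewrite isog_sym isogEcard (@card_dihedral 3) //.
rewrite cardsT card_kreweras_isometry_group leqnn andbT.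
rewrite (@Grp_dihedral 3) //; apply/existsP; exists (r, s) => /=.
by rewrite rsT r3 expgS ss rJ.
Qed.

(** A morphism whose domain is the full set is multiplicative everywhere, and its injectivity with
    equal cardinalities gives bijectivity. *)
Lemma isog_multiplicative (aT rT : finGroupType) :
  [set: aT] \isog [set: rT] -> exists f : {multiplicative aT -> rT}, bijective f.
Proof.
case/isogP => phi phi_inj phiT.
have phiM : {morph phi : x y / (x * y)%g} by move=> x y; rewrite morphM ?inE.
pose f : {multiplicative aT -> rT} :=
  HB.pack (phi : aT -> rT) (isMultiplicative.Build aT rT phi phiM).
exists f; apply: inj_card_bij => [x y|]; first by move/(injmP phi_inj); apply.
by rewrite -!cardsT -phiT card_injm.
Qed.

Theorem theorem3 :
  (exists f : {multiplicative 'D_6 -> kreweras_isometry_group}, bijective f) /\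
  ([set: kreweras_isometry_group] #= `I_6)%card /\
  kreweras_isometry =i
    [:: mx2 1 0 0 1;
        mx2 (-1) (-1) 0 1;
        mx2 1 0 (-1) (-1);
        mx2 (-1) (-1) 1 0;
        mx2 0 1 (-1) (-1);
        mx2 0 1 1 0].
Proof.
split; first exact: isog_multiplicative kreweras_isometry_group_dihedral.
split; last exact: mem_kreweras_matrices.
rewrite -card_kreweras_isometry_group (card_eqr card_II).
(* The enumeration [enum_val] is an injection from the ordinals onto the whole group, which carries
   the finite-type cardinal over to set-theoretic equipotence. *)
have <- : range (@enum_val kreweras_isometry_group predT) = setT.
  by apply/seteqP; split=> // g _; exists (enum_rank g); rewrite ?enum_rankK.
exact: inj_card_eq (in2W enum_val_inj).
Qed.
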